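(* Let $G$ be a step $s$ Carnot group. For any $\alpha \in (0,1)$ there exists $C > 0$ depending on $\alpha$, $d_{HS}$, and the Euclidean structure so that the following holds for every $E\subset G$. If $p_1,p_2,p_3 \in E$ are orderable points (with respect to $d_{HS}$) such that $\alpha \ell \leq d_{HS}(p_i,p_j) \leq \ell$ for some $\ell > 0$ when $i \neq j$, then $$d_{HS}(p_1,p_2) + d_{HS}(p_2,p_3) - d_{HS}(p_1,p_3) \leq C\, \hat{\beta}_E(p_i,2\ell)^{2s}\, \ell$$ for any $i \in \{1,2,3\}$.
   Context: A Carnot group of step $s$ is a simply connected Lie group $G$ whose Lie algebra has a stratification $\mathfrak g = V_1\oplus\cdots\oplus V_s$ with $[V_1,V_j]=V_{j+1}$ for $j\ge 1$ (with $V_k=0$ for $k>s$ and $V_s\ne 0$). Via $\exp$ and a choice of bases of the $V_i$, $G$ is identified with $\mathbb R^n=\mathbb R^{n_1+\cdots+n_s}$, $n_i=\dim V_i$ (exponential coordinates $g=(g_1,\dots,g_s)$, identity $0$). The automorphisms $\delta_\lambda(g_1,\dots,g_s)=(\lambda g_1,\lambda^2 g_2,\dots,\lambda^s g_s)$ are the dilations. For $1\le i\le s$, $\pi_i:G\to G/\exp(V_{i+1}\oplus\cdots\oplus V_s)$ is the quotient homomorphism, $\pi_i(g)=(g_1,\dots,g_i)$; $\pi_i(G)\cong\mathbb R^{n_1+\cdots+n_i}$ is again a Carnot group. Hebisch–Sikora norm: let $\|\cdot\|$ be the standard Euclidean norm in coordinates and fix a sufficiently small $\eta_*>0$; set $N_{HS}(g)=\inf\{\lambda>0:\|\delta_{1/\lambda}(g)\|<\eta_*\}$,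 on $G$ and (same formula, same $\eta_*$) on each $\pi_i(G)$. For $\eta_*$ small (by Hebisch–Sikora) these are all subadditive homogeneous norms, smooth away from $0$. Put $d_{HS}(g,h)=N_{HS}(g^{-1}h)$ on $G$ and on each $\pi_i(G)$. Distance to a set is the infimum of distances. An ordered triple $p_1,p_2,p_3$ in a metric space is orderable if $d(p_1,p_3)\ge\max\{d(p_1,p_2),d(p_2,p_3)\}$. A horizontal line is a set $\{g\exp(tv): t\in\mathbb R\}$ with $g\in G$, $v\in V_1\setminus\{0\}$. The stratified $\beta$-number (computed with $d_{HS}$, $B(x,r)$ the $d_{HS}$-ball) is defined by $$\hat{\beta}_E(x,r)^{2s} := \inf_L \sum_{i=1}^s \sup_{z \in E \cap B(x,r)} \left(\frac{d_{HS}(\pi_i(z),\pi_i(L))}{r}\right)^{2i},$$ the infimum being over horizontal lines $L\subset G$. *)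

(* Defs.v *)
From mathcomp Require Import all_boot all_order all_algebra.
From mathcomp Require Import all_classical all_reals all_analysis.
Set Implicit Arguments.
Unset Strict Implicit.
Unset Printing Implicit Defensive.
Import Order.TTheory GRing.Theory Num.Theory.
Local Open Scope classical_set_scope.
Local Open Scope ring_scope.

(* The Baker-Campbell-Hausdorff series in Dynkin's form, cut at s.
   The word attached to f : i |-> (r_i, q_i) is
     x^r_1 y^q_1 ... x^r_k y^q_k,
   read as the right-nested bracket [w_1, [w_2, [..., w_m]]], and its
   coefficient is
     (-1)^(k-1) / (k * (sum_i (r_i + q_i)) * prod_i (r_i! q_i!)).
   In a Lie algebra of step s every bracket of more than s factors is 0, so
   restricting to k, r_i, q_i <= s keeps all nonzero terms of the series. *)
Section BCH.
Variables (R : fieldType) (V : lmodType R) (br : V -> V -> V).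

Fixpoint nested_bracket (w : seq V) : V :=
  match w with
  | [::] => 0
  | [:: a] => a
  | a :: w' => br a (nested_bracket w')
  end.

Definition dynkin_word k s (f : {ffun 'I_k -> 'I_s.+1 * 'I_s.+1}) (x y : V) :=
  flatten [seq nseq (f i).1 x ++ nseq (f i).2 y | i <- enum 'I_k].

Definition dynkin_coef k s (f : {ffun 'I_k -> 'I_s.+1 * 'I_s.+1}) : R :=
  (-1) ^+ k.-1 /
  (k * (\sum_i ((f i).1 + (f i).2)) * \prod_i ((f i).1`! * (f i).2`!))%N%:R.

Definition bch (s : nat) (x y : V) : V :=
  \sum_(1 <= k < s.+1)
    \sum_(f : {ffun 'I_k -> 'I_s.+1 * 'I_s.+1}
           | [forall i, (0 < (f i).1 + (f i).2)%N])
       dynkin_coef f *: nested_bracket (dynkin_word f x y).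

End BCH.

(* deg j is the layer containing the j-th basis vector. *)
Definition layer (R : fieldType) n (deg : 'I_n -> nat) (i : nat) :
    {vspace 'rV[R]_n} :=
  <<[seq delta_mx 0%R j | j <- enum 'I_n & deg j == i]>>%VS.

(* [U, W], the linear span of the brackets [u, w] (cf. prodv). *)
Definition bracketv (R : fieldType) (vT : vectType R) (br : vT -> vT -> vT)
    (U W : {vspace vT}) : {vspace vT} :=
  <<allpairs br (vbasis U) (vbasis W)>>%VS.

(* A Carnot group of step s and dimension n in exponential coordinates:
   R^n carries both the stratified Lie algebra (bracket) and the group law
   (cmul), with exp the identity map, so that the two are related by the
   Baker-Campbell-Hausdorff formula, the identity is 0 and the inverse of g
   is - g. The coordinates are adapted to the stratification: V_i is spanned
   by the basis vectors of degree i, listed in order of degree. *)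
Record carnotGroup (R : realType) (s n : nat) := CarnotGroup {
  deg : 'I_n -> nat;
  bracket : 'rV[R]_n -> 'rV[R]_n -> 'rV[R]_n;
  cmul : 'rV[R]_n -> 'rV[R]_n -> 'rV[R]_n;
  deg_bounds : forall j, (1 <= deg j <= s)%N;
  deg_sorted : forall j k : 'I_n, (j <= k)%N -> (deg j <= deg k)%N;
  bracket_linearl : forall y, linear (bracket ^~ y);
  bracket_linearr : forall x, linear (bracket x);
  bracket_alt : forall x, bracket x x = 0;
  bracket_jacobi : forall x y z,
    bracket x (bracket y z) + bracket y (bracket z x)
      + bracket z (bracket x y) = 0;
  bracket_strat : forall j, (1 <= j)%N ->
    bracketv bracket (layer R deg 1) (layer R deg j) = layer R deg j.+1;
  top_layer_neq0 : layer R deg s <> 0%VS;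
  cmulA : associative cmul;
  cmul0g : left_id 0 cmul;
  cmulNg : forall x, cmul (- x) x = 0;
  cmulE : forall x y, cmul x y = bch bracket s x y
}.

(* The norm `|x| of 'rV[R]_n is the sup norm, hence this definition. *)
Definition euclidean_norm (R : realType) n (x : 'rV[R]_n) : R :=
  Num.sqrt (\sum_j x 0 j ^+ 2).

Section Carnot.
Variables (R : realType) (s n : nat) (G : carnotGroup R s n).
Implicit Types (g h x y z v : 'rV[R]_n) (i : nat).

Definition dilation (lambda : R) g : 'rV[R]_n :=
  \row_j (lambda ^+ deg G j * g 0 j).

(* The quotient pi_i(G) is realized on the vectors of R^n whose coordinates
   of degree > i vanish, i.e. on R^(n_1 + ... + n_i) padded with zeros; its
   group law is qmul i. *)
Definition cproj i g : 'rV[R]_n := \row_j (if (deg G j <= i)%N then g 0 j else 0).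

Definition qmul i x y : 'rV[R]_n := cproj i (cmul G x y).

(* Since padding with zeros changes neither the dilations nor the Euclidean
   norm, this is the norm on G and on every pi_i(G). *)
Definition NHS (eta : R) g : R :=
  inf [set lambda | 0 < lambda /\ euclidean_norm (dilation lambda^-1 g) < eta].

Definition dHS eta g h : R := NHS eta (cmul G (- g) h).

(* The distance of pi_i(G). *)
Definition qdHS eta i x y : R := NHS eta (qmul i (- x) y).

Definition qdist_set eta i x (A : set 'rV[R]_n) : R :=
  inf [set qdHS eta i x y | y in A].

Definition dball eta x (r : R) : set 'rV[R]_n := [set z | dHS eta x z < r].

Definition horizontal_line (L : set 'rV[R]_n) : Prop :=
  exists g v, [/\ v \in layer R (deg G) 1, v != 0 &
                  L = [set cmul G g (t *: v) | t in [set: R]]].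

(* The suprema and the infimum are those of nonempty sets bounded in the
   relevant direction as soon as E meets the ball. *)
Definition strat_beta eta (E : set 'rV[R]_n) x (r : R) : R :=
  (inf [set \sum_(1 <= i < s.+1)
              sup [set (qdist_set eta i (cproj i z) (cproj i @` L) / r) ^+ (2 * i)
                  | z in E `&` dball eta x r]
       | L in horizontal_line]) `^ ((2 * s)%:R^-1).

End Carnot.

Definition orderable (R : realType) (T : Type) (d : T -> T -> R) (p1 p2 p3 : T) :=
  d p1 p3 >= Num.max (d p1 p2) (d p2 p3).

(* Main.v *)
Require Import Defs.
From mathcomp Require Import all_boot all_order all_algebra.
From mathcomp Require Import all_classical all_reals all_analysis.
From mathcomp Require Import ring lra.
Import Order.TTheory GRing.Theory Num.Theory.
Import numFieldNormedType.Exports.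
Local Open Scope classical_set_scope.
Local Open Scope ring_scope.

(* Translate and dilate so that l = 1 and the line is {t v} with |v| = 1, and
   write p_j = (t_j v) w_j with t_j the first-layer component of p_j along v.
   If d(pi_k p_j, pi_k L) < r_k for every k, then t_j is within O(r_k) of the
   parameter of a point of pi_k(L) near pi_k(p_j), so the layer of w_j of
   degree k is O(r_k^k); hence the Euclidean norm of w_j is O(sqrt S), where
   S = sum_k r_k^(2k). The group law being locally Lipschitz,
   p_i^-1 p_j = T v + O(sqrt S) with T = t_j - t_i, the error being orthogonal
   to v. For such a point |T| <= eta N <= |T| + O(S): the lower bound is
   Cauchy-Schwarz on the first layer, and the upper bound holds because the
   layers enter the equation defining N only through their squared lengths.
   The excess is thus |t_2 - t_1| + |t_3 - t_2| - |t_3 - t_1| up to O(S), and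
   orderability puts t_2 between t_1 and t_3 unless S is bounded below. *)

(** * The graded Lie algebra, and the group law as a combination of nested brackets *)

Section CarnotAlgebra.
Set Implicit Arguments.
Unset Strict Implicit.
Variables (R : realType) (s n : nat) (G : carnotGroup R s n).
Implicit Types (g h x y z v : 'rV[R]_n) (a b t : R) (i d : nat) (w : seq bool).
Local Notation deg := (deg G).
Local Notation br := (bracket G).
Local Notation mul := (cmul G).

Lemma brDl x y z : br (x + y) z = br x z + br y z.
Proof. by have := bracket_linearl G z 1 x y; rewrite !scale1r. Qed.

Lemma brDr x y z : br x (y + z) = br x y + br x z.
Proof. by have := bracket_linearr G x 1 y z; rewrite !scale1r. Qed.

Lemma br0l x : br 0 x = 0.
Proof. by apply: (addrI (br 0 x)); rewrite -brDl !addr0. Qed.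

Lemma br0r x : br x 0 = 0.
Proof. by apply: (addrI (br x 0)); rewrite -brDr !addr0. Qed.

Lemma brZl a x y : br (a *: x) y = a *: br x y.
Proof. by have := bracket_linearl G y a x 0; rewrite !addr0 br0l addr0. Qed.

Lemma brZr a x y : br x (a *: y) = a *: br x y.
Proof. by have := bracket_linearr G x a y 0; rewrite !addr0 br0r addr0. Qed.

Lemma brNl x y : br (- x) y = - br x y.
Proof. by rewrite -scaleN1r brZl scaleN1r. Qed.

Lemma brNr x y : br x (- y) = - br x y.
Proof. by rewrite -scaleN1r brZr scaleN1r. Qed.

Lemma br_suml (I : Type) (r : seq I) (F : I -> 'rV[R]_n) y :
  br (\sum_(k <- r) F k) y = \sum_(k <- r) br (F k) y.
Proof. exact: (big_morph (br ^~ y) (fun x z => brDl x z y) (br0l y)). Qed.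

Lemma br_sumr (I : Type) (r : seq I) (F : I -> 'rV[R]_n) x :
  br x (\sum_(k <- r) F k) = \sum_(k <- r) br x (F k).
Proof. exact: (big_morph (br x) (brDr x) (br0r x)). Qed.

Lemma br_anti x y : br x y = - br y x.
Proof.
apply/eqP; rewrite -subr_eq0 opprK; apply/eqP.
by have := bracket_alt G (x + y); rewrite brDl !brDr !bracket_alt add0r addr0.
Qed.

Lemma mem_layerP x d :
  reflect (forall j, deg j != d -> x 0 j = 0) (x \in layer R deg d).
Proof.
apply: (iffP idP) => [xd j jd | xd].
  move: xd; rewrite /layer; set X := [seq _ | _ <- _ & _] => xd.
  rewrite (coord_span (X := in_tuple X) xd) summxE big1 // => k _.
  have : X`_k \in X by rewrite mem_nth.
  case/mapP => m; rewrite mem_filter => /andP[/eqP md _] ->.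
  rewrite !mxE eqxx /=; case: eqP => [jm | _]; last by rewrite mulr0.
  by rewrite jm md eqxx in jd.
rewrite [x]row_sum_delta; apply: memv_suml => j _.
have [jd | jd] := eqVneq (deg j) d; last by rewrite xd // scale0r mem0v.
apply/memvZ/memv_span/map_f.
by rewrite mem_filter jd eqxx mem_enum.
Qed.

Lemma delta_layer j : delta_mx 0 j \in layer R deg (deg j).
Proof.
apply/mem_layerP => k kj; rewrite mxE eqxx /=.
by case: eqP => // kj'; rewrite kj' eqxx in kj.
Qed.

Lemma br_layer1 d x y : (1 <= d)%N ->
  x \in layer R deg 1 -> y \in layer R deg d -> br x y \in layer R deg d.+1.
Proof.
move=> d1 x1 yd; rewrite -(bracket_strat G d1).
rewrite (coord_vbasis x1) br_suml; apply: memv_suml => j _.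
rewrite (coord_vbasis yd) br_sumr; apply: memv_suml => k _.
rewrite brZl brZr; apply/memvZ/memvZ/memv_span.
by apply: allpairs_f; rewrite mem_nth // size_tuple.
Qed.

(** Induction on [i]: by stratification an element of layer [i.+1] is a combination of brackets of
    [a] in layer 1 and [b] in layer [i], and Jacobi turns [br (br a b) y] into brackets with [a] on
    the outside or acting first on [y]. The latter raises [d], so [d] stays general. *)
Lemma br_layer i d x y : (1 <= i)%N -> (1 <= d)%N ->
  x \in layer R deg i -> y \in layer R deg d -> br x y \in layer R deg (i + d).
Proof.
move=> + d1; case: i => // i _; elim: i => [|i IH] in d d1 x y *.
  exact: br_layer1.
move=> xi yd; move: xi; rewrite -(bracket_strat G (isT : (1 <= i.+1)%N)) => xi.
rewrite (coord_span (X := in_tuple _) xi) br_suml; apply: memv_suml => k _.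
rewrite brZl; apply: memvZ.
set X := allpairs _ _ _ in k *.
have : X`_k \in X by rewrite mem_nth.
case/allpairsP => -[a b] /= [/vbasis_mem a1 /vbasis_mem bi ->].
have -> : br (br a b) y = br a (br b y) - br b (br a y).
  have := bracket_jacobi G a b y.
  rewrite (br_anti y (br a b)) (br_anti y a) brNr => /eqP.
  by rewrite subr_eq0 => /eqP.
rewrite rpredB //.
  by rewrite !addSn; apply: br_layer1 => //; apply: IH.
have -> : (i.+2 + d = i.+1 + d.+1)%N by rewrite !addSn addnS.
by apply: IH => //; apply: br_layer1.
Qed.

Lemma br_expand x y :
  br x y = \sum_j \sum_k (x 0 j * y 0 k) *: br (delta_mx 0 j) (delta_mx 0 k).
Proof.
rewrite {1}[x]row_sum_delta br_suml; apply: eq_bigr => j _.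
rewrite {1}[y]row_sum_delta br_sumr; apply: eq_bigr => k _.
by rewrite brZl brZr scalerA.
Qed.

(** The stratification as a statement about structure constants; compatibility of the bracket with
    dilations and with the quotients is read off from it. *)
Lemma br_delta_coord (j k m : 'I_n) : deg m != (deg j + deg k)%N ->
  br (delta_mx 0 j) (delta_mx 0 k) 0 m = 0.
Proof.
have /andP[j1 _] := deg_bounds G j; have /andP[k1 _] := deg_bounds G k.
exact/mem_layerP/br_layer/delta_layer/delta_layer.
Qed.

Lemma br_coord x y m : br x y 0 m =
  \sum_j \sum_k (x 0 j * y 0 k) * br (delta_mx 0 j) (delta_mx 0 k) 0 m.
Proof.
rewrite br_expand summxE; apply: eq_bigr => j _.
by rewrite summxE; apply: eq_bigr => k _; rewrite mxE.
Qed.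

Lemma dilationD a : {morph dilation G a : x y / x + y}.
Proof. by move=> x y; apply/rowP => j; rewrite !mxE mulrDr. Qed.

Lemma dilation0 a : dilation G a 0 = 0.
Proof. by apply/rowP => j; rewrite !mxE mulr0. Qed.

Lemma dilationZ a b x : dilation G a (b *: x) = b *: dilation G a x.
Proof. by apply/rowP => j; rewrite !mxE mulrCA. Qed.

Lemma dilationN a x : dilation G a (- x) = - dilation G a x.
Proof. by apply/rowP => j; rewrite !mxE mulrN. Qed.

Lemma dilationM a b x : dilation G a (dilation G b x) = dilation G (a * b) x.
Proof. by apply/rowP => j; rewrite !mxE exprMn mulrA. Qed.

Lemma dilation1 x : dilation G 1 x = x.
Proof. by apply/rowP => j; rewrite !mxE expr1n mul1r. Qed.

Lemma dilation_layer1 a x : x \in layer R deg 1 -> dilation G a x = a *: x.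
Proof.
move=> /mem_layerP x1; apply/rowP => j; rewrite !mxE.
by have [->|/x1->] := eqVneq (deg j) 1%N; rewrite ?expr1 // !mulr0.
Qed.

Lemma cprojD i : {morph cproj G i : x y / x + y}.
Proof. by move=> x y; apply/rowP => j; rewrite !mxE; case: ifP; rewrite ?addr0. Qed.

Lemma cproj0 i : cproj G i 0 = 0.
Proof. by apply/rowP => j; rewrite !mxE if_same. Qed.

Lemma cprojZ i a x : cproj G i (a *: x) = a *: cproj G i x.
Proof. by apply/rowP => j; rewrite !mxE; case: ifP; rewrite ?mulr0. Qed.

Lemma cprojN i x : cproj G i (- x) = - cproj G i x.
Proof. by rewrite -scaleN1r cprojZ scaleN1r. Qed.

Lemma cproj_id i x : cproj G i (cproj G i x) = cproj G i x.
Proof. by apply/rowP => j; rewrite !mxE; case: (_ <= _)%N. Qed.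

Lemma cproj_dilation i a x :
  cproj G i (dilation G a x) = dilation G a (cproj G i x).
Proof. by apply/rowP => j; rewrite !mxE; case: ifP; rewrite ?mulr0. Qed.

Lemma cproj_layer1 i x : (1 <= i)%N -> x \in layer R deg 1 -> cproj G i x = x.
Proof.
move=> i1 /mem_layerP x1; apply/rowP => j; rewrite !mxE.
by have [->|/x1->] := eqVneq (deg j) 1%N; rewrite ?i1 // if_same.
Qed.

Lemma br_dilation a x y :
  br (dilation G a x) (dilation G a y) = dilation G a (br x y).
Proof.
apply/rowP => m; rewrite mxE !br_coord mulr_sumr; apply: eq_bigr => j _.
rewrite mulr_sumr; apply: eq_bigr => k _; rewrite !mxE.
have [->|mjk] := eqVneq (deg m) (deg j + deg k)%N; last first.
  by rewrite br_delta_coord // !mulr0.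
by rewrite exprD; ring.
Qed.

Lemma br_cproj i x y :
  cproj G i (br (cproj G i x) (cproj G i y)) = cproj G i (br x y).
Proof.
apply/rowP => m; rewrite !mxE; case: ifP => // mi; rewrite !br_coord.
apply: eq_bigr => j _; apply: eq_bigr => k _; rewrite !mxE.
have [mjk|mjk] := eqVneq (deg m) (deg j + deg k)%N; last first.
  by rewrite br_delta_coord // !mulr0.
(* Degrees add, so a surviving term of degree at most [i] has both its factors of degree at most
   [i]. *)
by rewrite !(leq_trans _ mi) // mjk ?leq_addr ?leq_addl.
Qed.

Lemma br_coord1 x y m : deg m = 1%N -> br x y 0 m = 0.
Proof.
move=> m1; rewrite br_coord big1 // => j _; rewrite big1 // => k _.
rewrite br_delta_coord ?mulr0 // m1.
have /andP[j1 _] := deg_bounds G j; have /andP[k1 _] := deg_bounds G k.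
by rewrite neq_ltn (leq_add j1 k1).
Qed.

(* A word in two letters: false stands for x and true for y. *)
Definition word_bracket w x y : 'rV[R]_n :=
  nested_bracket br [seq (if c then y else x) | c <- w].

Lemma word_bracket_cons c c' w x y :
  word_bracket (c :: c' :: w) x y = br (if c then y else x) (word_bracket (c' :: w) x y).
Proof. by []. Qed.

(** Separating the shape of a Dynkin word from the vectors put into it allows one word to be
    compared at several pairs of arguments. *)
Definition letters k (f : {ffun 'I_k -> 'I_s.+1 * 'I_s.+1}) : seq bool :=
  flatten [seq nseq (f j).1 false ++ nseq (f j).2 true | j <- enum 'I_k].

Lemma cmul_words x y : mul x y =
  \sum_(1 <= k < s.+1)
    \sum_(f : {ffun 'I_k -> 'I_s.+1 * 'I_s.+1}
           | [forall j, (0 < (f j).1 + (f j).2)%N])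
       dynkin_coef R f *: word_bracket (letters f) x y.
Proof.
rewrite cmulE /bch; apply: eq_bigr => k _; apply: eq_bigr => f _.
congr (_ *: nested_bracket _ _).
rewrite map_flatten -map_comp; congr flatten; apply: eq_map => j /=.
by rewrite map_cat !map_nseq.
Qed.

Lemma word_bracket_dilation w a x y :
  word_bracket w (dilation G a x) (dilation G a y) = dilation G a (word_bracket w x y).
Proof.
elim: w => [|c [|c' w] IH]; first by rewrite dilation0.
  by case: c.
by rewrite !word_bracket_cons IH -br_dilation; case: c.
Qed.

Lemma word_bracket_cproj w i x y :
  cproj G i (word_bracket w (cproj G i x) (cproj G i y)) = cproj G i (word_bracket w x y).
Proof.
elim: w => [|c [|c' w] IH] //.
  by case: c; exact: cproj_id.
rewrite !word_bracket_cons -br_cproj IH -[RHS]br_cproj.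
by congr (cproj _ _ (br _ _)); case: c; rewrite cproj_id.
Qed.

Lemma cmul_dilation a x y :
  mul (dilation G a x) (dilation G a y) = dilation G a (mul x y).
Proof.
rewrite !cmul_words (big_morph _ (dilationD a) (dilation0 a)).
apply: eq_bigr => k _; rewrite (big_morph _ (dilationD a) (dilation0 a)).
by apply: eq_bigr => f _; rewrite dilationZ word_bracket_dilation.
Qed.

Lemma cmul_cproj i x y :
  cproj G i (mul (cproj G i x) (cproj G i y)) = cproj G i (mul x y).
Proof.
rewrite !cmul_words !(big_morph _ (cprojD i) (cproj0 i)).
apply: eq_bigr => k _; rewrite !(big_morph _ (cprojD i) (cproj0 i)).
by apply: eq_bigr => f _; rewrite !cprojZ word_bracket_cproj.
Qed.

Lemma cmulg0 x : mul x 0 = x.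
Proof.
have := cmulNg G (- x); rewrite opprK => xN.
by rewrite -{1}(cmulNg G x) cmulA xN cmul0g.
Qed.

Lemma cmulgN x : mul x (- x) = 0.
Proof. by have := cmulNg G (- x); rewrite opprK. Qed.

Lemma cmulKg x y : mul (- x) (mul x y) = y.
Proof. by rewrite cmulA cmulNg cmul0g. Qed.

Lemma cmulKVg x y : mul x (mul (- x) y) = y.
Proof. by rewrite cmulA cmulgN cmul0g. Qed.

Lemma cmulNN x y : - mul x y = mul (- y) (- x).
Proof.
rewrite -[RHS](cmulKg (mul x y)) -[mul (mul x y) _](cmulA G).
by rewrite cmulKVg cmulgN cmulg0.
Qed.

(* Comparing with cmulg0 and cmul0g gives the linear part of the
   Baker-Campbell-Hausdorff series without computing its coefficients. *)
Lemma cmul_additive (T : 'rV[R]_n -> 'rV[R]_n) x y :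
  {morph T : u v / u + v} -> (forall a u, T (a *: u) = a *: T u) ->
  (forall w, T (word_bracket w x y) = T (word_bracket w x 0) + T (word_bracket w 0 y)) ->
  T (mul x y) = T x + T y.
Proof.
move=> TD TZ Tw.
have T0 : T 0 = 0 by rewrite -(scale0r (0 : 'rV[R]_n)) TZ !scale0r.
rewrite -{2}(cmulg0 x) -{2}(cmul0g G y) !cmul_words.
rewrite !(big_morph T TD T0) -big_split; apply: eq_bigr => k _ /=.
rewrite !(big_morph T TD T0) -big_split; apply: eq_bigr => f _ /=.
by rewrite !TZ Tw scalerDr.
Qed.

Lemma cmul_coord1 x y m : deg m = 1%N -> mul x y 0 m = x 0 m + y 0 m.
Proof.
(* [cmul_additive] takes vector-valued maps, so the coordinate is placed back on its axis. *)
move=> m1; pose T (u : 'rV[R]_n) : 'rV[R]_n := u 0 m *: delta_mx 0 m.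
suff /rowP/(_ m) : T (mul x y) = T x + T y by rewrite !mxE !eqxx !mulr1.
apply: cmul_additive => [u v|a u|w].
- by rewrite /T mxE scalerDl.
- by rewrite /T mxE scalerA.
- case: w => [|c [|c' w]].
  + by rewrite /T mxE scale0r addr0.
  + by case: c; rewrite /T /= mxE scale0r ?addr0 ?add0r.
  + by rewrite /T !word_bracket_cons !br_coord1 // !scale0r addr0.
Qed.

Lemma cmul_line t t' v : mul (t *: v) (t' *: v) = (t + t') *: v.
Proof.
suff H w b b' : (1 < size w)%N -> word_bracket w (b *: v) (b' *: v) = 0.
  rewrite scalerDl; apply: (@cmul_additive id) => // -[|c [|c' w]].
  - by rewrite addr0.
  - by case: c; rewrite /word_bracket /= ?addr0 ?add0r.
  - by rewrite -{1 2}(scale0r v) /= !H // addr0.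
case: w => [|c [|c' w]] // _.
rewrite word_bracket_cons.
(* Every bracket of multiples of [v] is again a multiple of [v], so one more bracket kills it. *)
have [e ->] : exists e, word_bracket (c' :: w) (b *: v) (b' *: v) = e *: v.
  elim: w c' => [|c'' w IH] c'; first by case: c'; [exists b' | exists b].
  rewrite word_bracket_cons; have [e ->] := IH c''.
  by exists 0; case: c'; rewrite brZl brZr bracket_alt !scaler0 scale0r.
by case: c; rewrite brZl brZr bracket_alt !scaler0.
Qed.

End CarnotAlgebra.

(** * Local Lipschitz bounds for the group law, and homogeneous boxes *)

Section Lipschitz.
Set Implicit Arguments.
Unset Strict Implicit.
Variables (R : realType) (s n : nat) (G : carnotGroup R s n).
Implicit Types (x y z v : 'rV[R]_n) (i m : 'I_n) (F : 'rV[R]_n -> 'rV[R]_n -> 'rV[R]_n).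
Local Notation br := (bracket G).

Lemma coord_le_norm x i : `|x 0 i| <= `|x|.
Proof.
rewrite [leRHS]mx_normrE.
exact: (le_bigmax _ (fun ij : 'I_1 * 'I_n => `|x ij.1 ij.2|) (0, i)).
Qed.

Lemma norm_le_coord x (M : R) : 0 <= M -> (forall i, `|x 0 i| <= M) -> `|x| <= M.
Proof.
move=> M0 xM; rewrite [leLHS]mx_normrE.
by apply: bigmax_le => // -[j k] _ /=; rewrite (ord1 j).
Qed.

(** The bound on the values is carried along with the Lipschitz estimate because the product rule
    for brackets consumes it; one constant serves both. *)
Definition lip F := forall M : R, exists2 K : R, 0 <= K &
  forall x y x' y', `|x| <= M -> `|y| <= M -> `|x'| <= M -> `|y'| <= M ->
    `|F x y| <= K /\ `|F x y - F x' y'| <= K * (`|x - x'| + `|y - y'|).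

Lemma lip_ext F F' : (forall x y, F x y = F' x y) -> lip F -> lip F'.
Proof.
move=> FF' lF M; have [K K0 FK] := lF M; exists K => // x y x' y'.
by rewrite -!FF'; apply: FK.
Qed.

Lemma lip0 : lip (fun _ _ => 0).
Proof. by move=> M; exists 0 => // *; rewrite subrr !normr0 mul0r. Qed.

Lemma lip_fst : lip (fun x _ => x).
Proof.
move=> M; exists (1 + `|M|) => // x y x' y' xM _ _ _.
have := ler_norm M; have := normr_ge0 M.
have := normr_ge0 (x - x'); have := normr_ge0 (y - y').
by move=> *; split; [lra|nra].
Qed.

Lemma lip_snd : lip (fun _ y => y).
Proof.
move=> M; exists (1 + `|M|) => // x y x' y' _ yM _ _.
have := ler_norm M; have := normr_ge0 M.
have := normr_ge0 (x - x'); have := normr_ge0 (y - y').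
by move=> *; split; [lra|nra].
Qed.

Lemma lipD F F' : lip F -> lip F' -> lip (fun x y => F x y + F' x y).
Proof.
move=> lF lF' M; have [K K0 FK] := lF M; have [K' K0' FK'] := lF' M.
exists (K + K'); first exact: addr_ge0.
move=> x y x' y' xM yM xM' yM'.
have [h1 h2] := FK _ _ _ _ xM yM xM' yM'; have [h1' h2'] := FK' _ _ _ _ xM yM xM' yM'.
split; first exact: le_trans (ler_normD _ _) (lerD h1 h1').
rewrite opprD addrACA mulrDl; exact: le_trans (ler_normD _ _) (lerD h2 h2').
Qed.

Lemma lipZ F (a : R) : lip F -> lip (fun x y => a *: F x y).
Proof.
move=> lF M; have [K K0 FK] := lF M; exists (`|a| * K); first exact: mulr_ge0.
move=> x y x' y' xM yM xM' yM'; have [h1 h2] := FK _ _ _ _ xM yM xM' yM'.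
by rewrite -scalerBr !normrZ -mulrA; split; apply: ler_wpM2l.
Qed.

Lemma lip_sum (I : Type) (r : seq I) (P : pred I)
    (F : I -> 'rV[R]_n -> 'rV[R]_n -> 'rV[R]_n) :
  (forall k, lip (F k)) -> lip (fun x y => \sum_(k <- r | P k) F k x y).
Proof.
move=> lF; elim: r => [|k r IH].
  by apply: lip_ext lip0 => x y; rewrite big_nil.
have [Pk | Pk] := boolP (P k).
  by apply: lip_ext (lipD (lF k) IH) => x y; rewrite big_cons Pk.
by apply: lip_ext IH => x y; rewrite big_cons (negbTE Pk).
Qed.

Lemma br_bounded : exists2 K : R, 0 <= K & forall x y, `|br x y| <= K * `|x| * `|y|.
Proof.
exists (\sum_j \sum_k `|br (delta_mx 0 j) (delta_mx 0 k)|).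
  by apply: sumr_ge0 => j _; apply: sumr_ge0.
move=> x y; rewrite br_expand !mulr_suml.
apply: le_trans (ler_norm_sum _ _ _) (ler_sum _ _) => j _; rewrite !mulr_suml.
apply: le_trans (ler_norm_sum _ _ _) (ler_sum _ _) => k _.
rewrite normrZ mulrC -mulrA; apply: ler_wpM2l => //.
by rewrite normrM; apply: ler_pM => //; exact: coord_le_norm.
Qed.

Lemma lip_br F F' : lip F -> lip F' -> lip (fun x y => br (F x y) (F' x y)).
Proof.
have [B B0 brB] := br_bounded.
move=> lF lF' M; have [K K0 FK] := lF M; have [K' K0' FK'] := lF' M.
(* The difference of the two brackets is split by changing one factor at a time, and each half costs
   [B * K * K']. *)
exists (B * K * K' *+ 2); first by rewrite mulrn_wge0 // !mulr_ge0.
move=> x y x' y' xM yM xM' yM'.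
have [h1 h2] := FK _ _ _ _ xM yM xM' yM'; have [h1' h2'] := FK' _ _ _ _ xM yM xM' yM'.
have [h3 _] := FK _ _ _ _ xM' yM' xM yM.
have bnd u v a b : `|u| <= a -> `|v| <= b -> `|br u v| <= B * a * b.
  move=> ua vb; apply: le_trans (brB u v) _.
  by apply: ler_pM => //; [exact: mulr_ge0|exact: ler_wpM2l].
split.
  apply: le_trans (bnd _ _ _ _ h1 h1') _.
  by rewrite mulr2n lerDl !mulr_ge0.
have -> : br (F x y) (F' x y) - br (F x' y') (F' x' y') =
    br (F x y - F x' y') (F' x y) + br (F x' y') (F' x y - F' x' y').
  by rewrite brDl brNl brDr brNr addrA subrK.
apply: le_trans (ler_normD _ _) _.
apply: le_trans (lerD (bnd _ _ _ _ h2 h1') (bnd _ _ _ _ h3 h2')) _.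
by rewrite le_eqVlt; apply/orP; left; apply/eqP; ring.
Qed.

Lemma lip_word_bracket w : lip (word_bracket G w).
Proof.
have lip1 (c : bool) : lip (fun x y => if c then y else x).
  by case: c; [exact: lip_snd | exact: lip_fst].
elim: w => [|c [|c' w] IH]; [exact: lip0 | exact: lip1 |].
exact: lip_br (lip1 c) IH.
Qed.

Lemma lip_cmul : lip (cmul G).
Proof.
apply: lip_ext (fun x y => esym (cmul_words G x y)) _.
by apply: lip_sum => k; apply: lip_sum => f; apply/lipZ/lip_word_bracket.
Qed.

(** A coordinatewise substitute for the homogeneous ball of radius [rho]: dilating by [rho^-1]
    brings it into a fixed sup-norm ball. *)
Definition box (M rho : R) x := forall i, `|x 0 i| <= M * rho ^+ deg G i.

Lemma box_dilation (M rho : R) x : 0 < rho -> 0 <= M ->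
  box M rho x -> `|dilation G rho^-1 x| <= M.
Proof.
move=> r0 M0 xM; apply: norm_le_coord => // i.
rewrite mxE normrM exprVn normfV (ger0_norm (exprn_ge0 _ (ltW r0))).
by rewrite mulrC ler_pdivrMr ?exprn_gt0.
Qed.

(** Dilations are automorphisms, so rescaling reduces to [rho = 1], where the group law is bounded
    on bounded sets; hence [K] does not depend on [rho]. *)
Lemma cmul_box (M : R) : 0 <= M -> exists2 K : R, 0 <= K &
  forall (rho : R) x y, 0 < rho -> box M rho x -> box M rho y ->
    box K rho (cmul G x y).
Proof.
move=> M0; have [K K0 lK] := lip_cmul M; exists K => // rho x y r0 xM yM i.
have [+ _] := lK _ _ _ _ (box_dilation r0 M0 xM) (box_dilation r0 M0 yM)
  (box_dilation r0 M0 xM) (box_dilation r0 M0 yM).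
rewrite cmul_dilation => /(le_trans (coord_le_norm _ i)).
rewrite mxE normrM exprVn normfV (ger0_norm (exprn_ge0 _ (ltW r0))).
by rewrite mulrC ler_pdivrMr ?exprn_gt0.
Qed.

End Lipschitz.

(** * The Hebisch-Sikora norm, compared with boxes and with projection onto a horizontal
    direction *)

Section HebischSikoraNorm.
Set Implicit Arguments.
Unset Strict Implicit.
Variables (R : realType) (s n : nat) (G : carnotGroup R s n).
Variables (eta : R) (eta_gt0 : 0 < eta).
Implicit Types (x y z v : 'rV[R]_n) (i m : 'I_n).
Local Notation NHS := (NHS G eta).

Definition dot x y : R := \sum_m x 0 m * y 0 m.

Lemma dotDl x y v : dot (x + y) v = dot x v + dot y v.
Proof. by rewrite -big_split; apply: eq_bigr => m _; rewrite mxE mulrDl. Qed.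

Lemma dotZl (a : R) x v : dot (a *: x) v = a * dot x v.
Proof. by rewrite mulr_sumr; apply: eq_bigr => m _; rewrite mxE mulrA. Qed.

Lemma dotNl x v : dot (- x) v = - dot x v.
Proof. by rewrite -scaleN1r dotZl mulN1r. Qed.

Lemma dot_cmul x y v : v \in layer R (deg G) 1 ->
  dot (cmul G x y) v = dot x v + dot y v.
Proof.
move=> /mem_layerP v1; rewrite -big_split; apply: eq_bigr => m _ /=.
have [m1|/v1->] := eqVneq (deg G m) 1%N; last by rewrite !mulr0 addr0.
by rewrite cmul_coord1 // mulrDl.
Qed.

Lemma dot_cproj k x v : (1 <= k)%N -> v \in layer R (deg G) 1 ->
  dot (cproj G k x) v = dot x v.
Proof.
move=> k1 /mem_layerP v1; apply: eq_bigr => m _; rewrite mxE.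
by have [->|/v1->] := eqVneq (deg G m) 1%N; rewrite ?k1 // !mulr0.
Qed.

Lemma dot_dilation (a : R) x v : v \in layer R (deg G) 1 ->
  dot (dilation G a x) v = a * dot x v.
Proof.
move=> /mem_layerP v1; rewrite mulr_sumr; apply: eq_bigr => m _; rewrite mxE.
by have [->|/v1->] := eqVneq (deg G m) 1%N; rewrite ?mulrA // !mulr0.
Qed.

(** Cauchy-Schwarz: the difference of the two sides is the squared length of [x - dot x v *: v]. *)
Lemma dot_sqr_le x v : dot v v = 1 -> dot x v ^+ 2 <= dot x x.
Proof.
move=> v1; rewrite -subr_ge0; set a := dot x v.
have -> : dot x x - a ^+ 2 = \sum_m (x 0 m - a * v 0 m) ^+ 2.
  rewrite (eq_bigr (fun m => x 0 m * x 0 m + ((- 2 * a) * (x 0 m * v 0 m)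
    + a ^+ 2 * (v 0 m * v 0 m)))); last by move=> m _; ring.
  rewrite !big_split /= -!mulr_sumr -/(dot x v) -/(dot v v) -/(dot x x) v1 -/a.
  by ring.
by apply: sumr_ge0 => m _; apply: sqr_ge0.
Qed.

Lemma unit_coord_le1 v m : dot v v = 1 -> `|v 0 m| <= 1.
Proof.
move=> v1; rewrite -(ler_pXn2r (n := 2)) ?nnegrE //.
rewrite expr1n -normrX ger0_norm ?sqr_ge0 // -v1 /dot (bigD1 m) //= -expr2 lerDl.
by apply: sumr_ge0 => k _; rewrite -expr2 sqr_ge0.
Qed.

Lemma euclidean_norm_lt x : (euclidean_norm x < eta) = (dot x x < eta ^+ 2).
Proof.
have xx : \sum_j x 0 j ^+ 2 = dot x x by apply: eq_bigr => m _; rewrite expr2.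
rewrite /euclidean_norm xx -[RHS](ltr_sqrt _ (exprn_gt0 2 eta_gt0)).
by rewrite sqrtr_sqr gtr0_norm.
Qed.

Local Notation levels x :=
  [set lambda | 0 < lambda /\ euclidean_norm (dilation G lambda^-1 x) < eta].

Lemma NHS_lbound x : has_lbound (levels x).
Proof. by exists 0 => a [/ltW]. Qed.

Lemma NHS_le x (a : R) : 0 < a ->
  dot (dilation G a^-1 x) (dilation G a^-1 x) < eta ^+ 2 -> NHS x <= a.
Proof.
move=> a0 xa; apply: (ge_inf (NHS_lbound x)).
by split => //; rewrite euclidean_norm_lt.
Qed.

Lemma levels_box (M : R) : 0 <= M -> exists2 K : R, 0 < K &
  forall (rho : R) x, 0 < rho -> box G M rho x -> levels x (K * rho).
Proof.
(* All degrees are at least 1 and [K >= 1], so dilating by [K^-1] divides each coordinate by at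
   least [K]. This [K] makes the results smaller than [eta / n.+1], and [n] such squares sum to less
   than [eta ^+ 2]. *)
move=> M0; pose K : R := 1 + n.+1%:R * M / eta.
have K1 : 1 <= K by rewrite lerDl !mulr_ge0 // invr_ge0 ltW.
have K0 : 0 < K by exact: lt_le_trans K1.
exists K => // rho x r0 xM; split; first exact: mulr_gt0.
rewrite euclidean_norm_lt.
have MK : M / K < eta / n.+1%:R.
  rewrite ltr_pdivrMr // mulrAC ltr_pdivlMr ?ltr0n // mulrDr mulr1 mulrC.
  rewrite [X in _ < _ + X]mulrC divfK ?gt_eqF //.
  by rewrite ltrDr.
have -> : (K * rho)^-1 = K^-1 * rho^-1 by rewrite invfM.
rewrite -dilationM; set y := dilation G rho^-1 x.
have yM m : `|y 0 m| <= M by apply: le_trans (box_dilation r0 M0 xM); exact: coord_le_norm.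
have n0 : 0 < n.+1%:R :> R by rewrite ltr0n.
apply: (@le_lt_trans _ _ (n%:R * (M / K) ^+ 2)).
  rewrite mulr_natl -[in leRHS](card_ord n) -sumr_const; apply: ler_sum => m _.
  rewrite -expr2 -real_normK ?num_real // ler_pXn2r ?nnegrE ?divr_ge0 ?(ltW K0) //.
  rewrite mxE normrM mulrC; apply: ler_pM => //.
  rewrite ger0_norm ?exprn_ge0 ?invr_ge0 ?(ltW K0) // -[leRHS]expr1.
  have /andP[m1 _] := deg_bounds G m.
  by apply: ler_wiXn2l => //; rewrite ?invr_ge0 ?(ltW K0) // invf_le1.
apply: (@le_lt_trans _ _ (n%:R * (eta / n.+1%:R) ^+ 2)).
  rewrite ler_wpM2l // ler_pXn2r ?nnegrE ?divr_ge0 ?(ltW K0) ?(ltW eta_gt0) //.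
  exact: ltW.
rewrite exprMn mulrCA gtr_pMr ?exprn_gt0 // exprVn ltr_pdivrMr ?exprn_gt0 // mul1r.
by rewrite -natrX ltr_nat (leq_trans (ltnSn n)) // leq_pmulr.
Qed.

Lemma levels_nonempty x : levels x !=set0.
Proof.
have [K _ Kx] := levels_box (normr_ge0 x).
exists (K * 1); apply: Kx => // m; rewrite expr1n mulr1; exact: coord_le_norm.
Qed.

Lemma NHS_box (M : R) : 0 <= M -> exists2 K : R, 0 < K &
  forall (rho : R) x, 0 < rho -> box G M rho x -> NHS x <= K * rho.
Proof.
move=> /levels_box[K K0 Kx]; exists K => // rho x r0 /(Kx _ _ r0).
exact: (ge_inf (NHS_lbound x)).
Qed.

Lemma NHS_ge0 x : 0 <= NHS x.
Proof. by apply: lb_le_inf (levels_nonempty x) _ => a [/ltW]. Qed.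

(** The admissible levels form an upward closed set, since a larger level shrinks every coordinate
    further. *)
Lemma NHS_lt x (a : R) : NHS x < a ->
  dot (dilation G a^-1 x) (dilation G a^-1 x) < eta ^+ 2.
Proof.
move=> /(inf_lt (levels_nonempty x))[b [b0]].
rewrite euclidean_norm_lt => xb /ltW ba; apply: le_lt_trans xb.
have a0 : 0 < a by exact: lt_le_trans ba.
apply: ler_sum => m _; rewrite -!expr2 !mxE !exprMn ler_wpM2r ?sqr_ge0 //.
rewrite ler_pXn2r ?nnegrE ?exprn_ge0 ?invr_ge0 ?(ltW a0) ?(ltW b0) //.
by apply: lerXn2r; rewrite ?nnegrE ?invr_ge0 ?(ltW a0) ?(ltW b0) // lef_pV2.
Qed.

Lemma NHS_gt x (a : R) : 0 < a -> a < NHS x ->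
  eta ^+ 2 <= dot (dilation G a^-1 x) (dilation G a^-1 x).
Proof. by move=> a0 ax; rewrite leNgt; apply/negP => /(NHS_le a0); rewrite leNgt ax. Qed.

Lemma NHS_lt_box x (a : R) : NHS x < a -> box G eta a x.
Proof.
move=> xa m; have a0 : 0 < a := le_lt_trans (NHS_ge0 x) xa.
rewrite -ler_pdivrMr ?exprn_gt0 //.
rewrite -(ler_pXn2r (n := 2)) ?nnegrE ?divr_ge0 ?exprn_ge0 ?(ltW a0) ?(ltW eta_gt0) //.
apply: le_trans (ltW (NHS_lt xa)); rewrite /dot (bigD1 m) //= -expr2 mxE.
rewrite !exprMn -normrX ger0_norm ?sqr_ge0 // mulrC !exprVn lerDl.
by apply: sumr_ge0 => k _; rewrite -expr2 sqr_ge0.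
Qed.

Lemma NHS0_le (a : R) : 0 < a -> NHS 0 <= a.
Proof.
move=> a0; apply: NHS_le => //; rewrite dilation0 /dot big1 ?exprn_gt0 // => m _.
by rewrite mxE mul0r.
Qed.

Lemma NHS_dilation (a : R) x : 0 < a -> NHS (dilation G a x) = a * NHS x.
Proof.
(* One inequality for all dilations suffices: the converse is the same inequality for the inverse
   dilation. *)
have le b y : 0 < b -> NHS (dilation G b y) <= b * NHS y.
  move=> b0; rewrite -ler_pdivrMl //; apply: lb_le_inf (levels_nonempty y) _.
  move=> c [c0]; rewrite euclidean_norm_lt ler_pdivrMl // => yc.
  apply: NHS_le; first exact: mulr_gt0.
  by rewrite dilationM invfM mulrAC mulVf ?gt_eqF // mul1r.
move=> a0; apply/eqP; rewrite eq_le le //= -ler_pdivlMl //.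
apply: le_trans (le _ _ _); last by rewrite invr_gt0.
by rewrite dilationM mulVf ?gt_eqF // dilation1.
Qed.

(** If the norm were below [a = |dot x v| / eta], the dilation of [x] by [a^-1] would have length
    less than [eta], although its component along [v] has absolute value exactly [eta]. *)
Lemma dot_le_NHS x v : v \in layer R (deg G) 1 -> dot v v = 1 ->
  `|dot x v| <= eta * NHS x.
Proof.
move=> v1 vv; rewrite leNgt mulrC -ltr_pdivlMr //; apply/negP => xv.
have := le_lt_trans (dot_sqr_le _ vv) (NHS_lt xv).
have c0 : 0 < `|dot x v| by rewrite -(pmulr_rgt0 _ (_ : 0 < eta^-1)) ?invr_gt0 //
  mulrC (le_lt_trans (NHS_ge0 x)).
rewrite dot_dilation // -[ltLHS]real_normK ?num_real // normrM invfM invrK.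
by rewrite normrM normfV normr_id mulrAC mulVf ?gt_eqF // mul1r gtr0_norm // ltxx.
Qed.

(* The deviation of x from the line through v enters the equation defining N
   only through its square, as it is orthogonal to v in the first layer. *)
Lemma NHS_le_dot (alpha A : R) : 0 < alpha <= 1 -> 0 <= A -> exists2 C : R, 0 <= C &
  forall x v (S : R), v \in layer R (deg G) 1 -> dot v v = 1 ->
    (forall m, (x 0 m - dot x v * v 0 m) ^+ 2 <= A * S) -> 0 <= S ->
    alpha <= NHS x -> eta * NHS x <= `|dot x v| + C * S.
Proof.
(* [B] dominates [a^-1 ^+ (2 * (d - 1))] for all degrees [d <= s] and all levels
   [a >= alpha / 2]. *)
move=> /andP[al0 al1] A0; pose B : R := (2 / alpha) ^+ (2 * s).
have B1 : 1 <= B.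
  by apply: exprn_ege1; rewrite ler_pdivlMr // mul1r (le_trans al1) // ler1n.
(* Chosen so that [C * S * (eta * (alpha / 2))] equals the error [B * n%:R * A * S] in [key]. *)
pose C : R := 2 * (B * n%:R * A) / (eta * alpha).
have B0 : 0 <= B by lra.
have C0 : 0 <= C by rewrite !mulr_ge0 // invr_ge0 ltW // mulr_gt0.
exists C => // x v S v1 vv xvS S0 alx; set T := dot x v in xvS *.
have key (a : R) : alpha / 2 <= a -> a < NHS x ->
    eta ^+ 2 * a ^+ 2 <= T ^+ 2 + B * n%:R * A * S.
  move=> ala ax; have a0 : 0 < a by lra.
  have := NHS_gt a0 ax; rewrite -(ler_pM2r (_ : 0 < a ^+ 2)) ?exprn_gt0 //.
  move=> /le_trans; apply.
  (* After multiplication by [a ^+ 2] the first layer has coefficient 1 and the higher layers, where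
     [v] vanishes, have coefficient at most [B]. The cross term sums to 0 because [h] is orthogonal
     to [v]. *)
  pose h m := x 0 m - T * v 0 m.
  apply: (@le_trans _ _ (\sum_m (T ^+ 2 * (v 0 m * v 0 m)
    + ((2 * T) * (h m * v 0 m) + B * h m ^+ 2)))).
    rewrite mulr_suml; apply: ler_sum => m _; rewrite !mxE.
    have /andP[m1 ms] := deg_bounds G m.
    have [d1|d1] := eqVneq (deg G m) 1%N.
      rewrite d1 expr1; have -> : a^-1 * x 0 m * (a^-1 * x 0 m) * a ^+ 2 = x 0 m ^+ 2.
        by field; rewrite gt_eqF.
      have -> : x 0 m = T * v 0 m + h m by rewrite /h; ring.
      by have := sqr_ge0 (h m); nra.
    have v0 : v 0 m = 0 by move/mem_layerP: v1; apply.
    rewrite /h v0 !mulr0 !add0r subr0.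
    have -> : a^-1 ^+ deg G m * x 0 m * (a^-1 ^+ deg G m * x 0 m) * a ^+ 2 =
        (a^-1 ^+ (2 * (deg G m).-1)) * x 0 m ^+ 2.
      have -> : deg G m = (deg G m).-1.+1 by rewrite prednK.
      rewrite /= mulnC exprM exprS; field; by rewrite gt_eqF.
    rewrite ler_wpM2r ?sqr_ge0 // /B.
    apply: (@le_trans _ _ ((2 / alpha) ^+ (2 * (deg G m).-1))).
      apply: lerXn2r; rewrite ?nnegrE ?divr_ge0 ?invr_ge0 ?(ltW a0) ?(ltW al0) //.
      by rewrite -[leRHS]invrK invf_div lef_pV2 ?posrE // divr_gt0.
    apply: ler_weXn2l; first by rewrite ler_pdivlMr // mul1r (le_trans al1) // ler1n.
    by rewrite leq_mul2l /= (leq_trans _ ms) // leq_pred.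
  rewrite !big_split /= -!mulr_sumr -/(dot v v) vv mulr1 lerD2l.
  have -> : \sum_m h m * v 0 m = 0.
    have := dotDl x (- T *: v) v; rewrite dotZl vv mulr1 -/T subrr => xv0; rewrite -[RHS]xv0.
    by apply: eq_bigr => m _; rewrite !mxE mulNr.
  rewrite mulr0 add0r -!mulrA ler_wpM2l //.
  rewrite mulr_natl -[in leRHS](card_ord n) -sumr_const; apply: ler_sum => m _.
  exact: xvS.
rewrite leNgt; apply/negP; rewrite -/T => lt_c.
pose c := (`|T| + C * S) / eta.
have cN : c < NHS x by rewrite ltr_pdivrMr // [ltRHS]mulrC.
(* A level strictly between [c] and the norm, and at least [alpha / 2] so that [key] applies to
   it. *)
pose a := Num.max (alpha / 2) ((NHS x + c) / 2).
have aa : alpha / 2 <= a by rewrite le_max lexx.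
have aN : a < NHS x by rewrite gt_max; apply/andP; split; lra.
have ca : c < a by rewrite lt_max; apply/orP; right; lra.
suff : T ^+ 2 + B * n%:R * A * S < (eta * a) ^+ 2 by rewrite exprMn ltNge key.
have ca' : `|T| + C * S < eta * a by rewrite [ltRHS]mulrC -ltr_pdivrMr.
have CS : B * n%:R * A * S = C * S * (eta * (alpha / 2)).
  by rewrite /C; field; rewrite !gt_eqF.
have CS0 : 0 <= C * S by exact: mulr_ge0.
have ea : eta * (alpha / 2) <= eta * a by rewrite ler_wpM2l // ltW.
rewrite CS -(real_normK (num_real T)).
move: (normr_ge0 T) ca' CS0 ea; move: `|T| (C * S) (eta * a) (eta * (alpha / 2)).
by move=> t e p q t0 tp e0 qp; nra.
Qed.

End HebischSikoraNorm.

(** * Points close, in every quotient, to a horizontal line through the identity *)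

Section NearLine.
Set Implicit Arguments.
Unset Strict Implicit.
Variables (R : realType) (s n : nat) (G : carnotGroup R s n).
Variables (eta : R) (eta_gt0 : 0 < eta).
Implicit Types (x y z v p q : 'rV[R]_n) (i m : 'I_n) (r : nat -> R).
Local Notation NHS := (NHS G eta).
Local Notation mul := (cmul G).

(** The parameter [t] may change with [k], as the stratified beta-number measures distance to the
    line separately in each quotient. *)
Definition near_line v r p := forall k, (1 <= k <= s)%N ->
  exists t : R, NHS (cproj G k (mul (- p) (t *: v))) < r k.

Lemma near_line_remainder : exists2 K : R, 0 <= K & forall p v r,
  v \in layer R (deg G) 1 -> dot v v = 1 -> (forall k, 0 < r k) ->
  near_line v r p ->
  forall m, `|mul (- (dot p v *: v)) p 0 m| <= K * r (deg G m) ^+ deg G m.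
Proof.
have [K K0 Kb] := cmul_box G (ltW eta_gt0); exists K => // p v r v1 vv r0 pv m.
have /andP[m1 ms] := deg_bounds G m; set k := deg G m in m1 ms *.
have [t] := pv k (deg_bounds G m); set x := mul (- p) (t *: v) => xr.
set tau := dot p v; set y := (tau - t) *: v.
(* The remainder is the inverse of [mul x y], and inversion is negation of coordinates. *)
have -> : mul (- (tau *: v)) p 0 m = - mul x y 0 m.
  have -> : mul x y = - mul (- (tau *: v)) p.
    by rewrite /x /y -cmulA cmul_line addrC subrK cmulNN opprK.
  by rewrite mxE opprK.
(* The coordinate [m] has degree [k], so it is seen in the quotient [k], the one where [x] is
   controlled. *)
have -> : mul x y 0 m = mul (cproj G k x) (cproj G k y) 0 m.
  have /rowP/(_ m) := cmul_cproj G k x y.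
  by rewrite !mxE leqnn => ->.
rewrite normrN; apply: Kb => //; first exact: NHS_lt_box.
rewrite cproj_layer1 // => [i|]; last exact: memvZ.
rewrite mxE normrM; have [i1|i1] := eqVneq (deg G i) 1%N; last first.
  move/mem_layerP: v1 => -> //.
  by rewrite normr0 mulr0 mulr_ge0 ?exprn_ge0 ?(ltW eta_gt0) ?(ltW (r0 _)).
rewrite i1 expr1 -[leRHS]mulr1; apply: ler_pM (unit_coord_le1 i vv) => //.
(* The parameter error is, up to sign, the component along [v] of the small element [x], hence at
   most [eta * r k]. *)
have -> : tau - t = - dot (cproj G k x) v.
  by rewrite dot_cproj // dot_cmul // dotNl dotZl vv mulr1 opprD opprK.
rewrite normrN; apply: le_trans (dot_le_NHS eta_gt0 _ v1 vv) _.
by rewrite ler_wpM2l ?(ltW eta_gt0) // ltW.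
Qed.

Local Notation total r := (\sum_(1 <= k < s.+1) r k ^+ (2 * k)).

Lemma near_line_dist (alpha : R) : 0 < alpha <= 1 -> exists2 C : R, 0 <= C &
  forall p q v r,
  v \in layer R (deg G) 1 -> dot v v = 1 -> (forall k, 0 < r k) ->
  total r <= 1 -> near_line v r p -> near_line v r q ->
  alpha <= dHS G eta p q <= 1 ->
  eta * dHS G eta p q <= `|dot q v - dot p v| + C * total r.
Proof.
move=> al; have [K K0 wK] := near_line_remainder.
(* [L] serves to compare [mul (T *: v) wq] with [T *: v], and [L'] to remove the left factor [- wp].
   The radius [K + L] covers the arguments of this second product. *)
have [L L0 lL] := lip_cmul G (K + eta).
have [L' L0' lL'] := lip_cmul G (K + L).
have [C C0 CN] := NHS_le_dot G eta_gt0 al (sqr_ge0 (L' * (K + L * K))).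
exists C => // p q v r v1 vv r0 S1 pv qv /andP[pqa pq1].
set S := total r in S1 *.
have S0 : 0 <= S by apply: sumr_ge0 => k _; rewrite exprn_ge0 // ltW.
set tp := dot p v; set tq := dot q v; pose T := tq - tp.
(* The square of [r k ^+ k] is one of the terms of [S], so each remainder coordinate is at most
   [K * Num.sqrt S]. *)
have wS z : near_line v r z -> `|mul (- (dot z v *: v)) z| <= K * Num.sqrt S.
  move=> zv; apply: norm_le_coord => [|m]; first by rewrite mulr_ge0 ?sqrtr_ge0.
  apply: le_trans (wK z v r v1 vv r0 zv m) _; rewrite ler_wpM2l //.
  have rk : 0 <= r (deg G m) ^+ deg G m by rewrite exprn_ge0 // ltW.
  rewrite -(ger0_norm rk) -sqrtr_sqr ler_sqrt // -exprM mulnC /S.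
  have /andP[m1 ms] := deg_bounds G m.
  rewrite (bigD1_seq (deg G m)) ?iota_uniq ?mem_index_iota ?m1 ?ltnS //= lerDl.
  by apply: sumr_ge0 => k _; rewrite exprn_ge0 // ltW.
set wp := mul (- (tp *: v)) p; set wq := mul (- (tq *: v)) q.
have wpS : `|wp| <= K * Num.sqrt S by exact: wS.
have wqS : `|wq| <= K * Num.sqrt S by exact: wS.
(* This keeps the remainders in a fixed ball, where the Lipschitz constants are valid. *)
have sS1 : Num.sqrt S <= 1 by rewrite -[leRHS]sqrtr1 ler_sqrt.
have wpK : `|wp| <= K by apply: le_trans wpS _; rewrite ler_piMr.
have wqK : `|wq| <= K by apply: le_trans wqS _; rewrite ler_piMr.
set x := mul (- p) q.
have xE : x = mul (- wp) (mul (T *: v) wq).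
  have -> : T *: v = mul (- (tp *: v)) (tq *: v).
    by rewrite -scaleNr cmul_line addrC.
  by rewrite /wp /wq -cmulA cmulKVg cmulNN opprK -cmulA cmulKVg.
have xT : dot x v = T by rewrite dot_cmul // dotNl addrC.
have Teta : `|T| <= eta.
  rewrite -xT; apply: le_trans (dot_le_NHS eta_gt0 _ v1 vv) _.
  by rewrite ler_piMr // ltW.
have Tv : `|T *: v| <= eta.
  apply: norm_le_coord => [|m]; first exact: ltW.
  rewrite mxE normrM -[leRHS]mulr1.
  by apply: ler_pM (unit_coord_le1 m vv).
have xTv m : (x 0 m - dot x v * v 0 m) ^+ 2 <= (L' * (K + L * K)) ^+ 2 * S.
  have e0 := ltW eta_gt0.
  have le1 : `|wq| <= K + eta by apply: le_trans wqK _; rewrite lerDl.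
  have le2 : `|T *: v| <= K + eta by apply: le_trans Tv _; rewrite lerDr.
  have le3 : `|0 : 'rV[R]_n| <= K + eta by rewrite normr0 addr_ge0.
  have [y1 y2] := lL _ _ _ _ le2 le1 le2 le3.
  have [y3 _] := lL _ _ _ _ le2 le3 le2 le1.
  rewrite cmulg0 subrr normr0 add0r subr0 in y2 y3.
  have le4 : `|- wp| <= K + L by rewrite normrN; apply: le_trans wpK _; rewrite lerDl.
  have le5 : `|0 : 'rV[R]_n| <= K + L by rewrite normr0 addr_ge0.
  have le6 : `|mul (T *: v) wq| <= K + L by apply: le_trans y1 _; rewrite lerDr.
  have le7 : `|T *: v| <= K + L by apply: le_trans y3 _; rewrite lerDr.
  have [_] := lL' _ _ _ _ le4 le6 le5 le7.
  rewrite -xE cmul0g subr0 normrN xT => h.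
  have -> : x 0 m - T * v 0 m = (x - T *: v) 0 m by rewrite !mxE.
  rewrite -real_normK ?num_real // -(sqr_sqrtr S0) -exprMn.
  apply: lerXn2r; rewrite ?nnegrE ?mulr_ge0 ?addr_ge0 ?sqrtr_ge0 ?mulr_ge0 //.
  apply: le_trans (coord_le_norm _ m) _; apply: le_trans h _.
  rewrite -mulrA ler_wpM2l // mulrDl lerD //.
  by apply: le_trans y2 _; rewrite -mulrA ler_wpM2l.
by have := CN x v S v1 vv xTv S0 pqa; rewrite xT.
Qed.

(* For the middle point to project outside the segment spanned by the other
   two, its distance to one of them would have to be of the order of e. *)
Lemma orderable_real (a e d01 d12 d02 t01 t12 : R) :
  0 < a <= 1 -> 0 <= e -> d01 <= 1 -> d12 <= 1 ->
  a <= d01 -> a <= d12 -> d01 <= d02 -> d12 <= d02 ->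
  eta * d01 <= `|t01| + e -> eta * d12 <= `|t12| + e ->
  eta * d02 <= `|t01 + t12| + e ->
  `|t01| <= eta * d01 -> `|t12| <= eta * d12 -> `|t01 + t12| <= eta * d02 ->
  d01 + d12 - d02 <= 4 / (eta * a) * e.
Proof.
move=> /andP[a0 a1] e0 l01 l12 a01 a12 o01 o12 u01 u12 u02 b01 b12 b02.
have ea0 : 0 < eta * a by exact: mulr_gt0.
have ead01 : eta * a <= eta * d01 by rewrite ler_pM2l.
have ead12 : eta * a <= eta * d12 by rewrite ler_pM2l.
have e01 : eta * d01 <= eta * d02 by rewrite ler_pM2l.
have e12 : eta * d12 <= eta * d02 by rewrite ler_pM2l.
rewrite mulrAC ler_pdivlMr //.
(* If [t01] and [t12] have the same sign, the lengths add up and only the two upper errors remain,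
   which is the first case. *)
have [le|gt] := leP (eta * (d01 + d12 - d02)) (2 * e).
  have h : eta * (d01 + d12 - d02) * a <= 2 * e * a by rewrite ler_pM2r.
  have h' : 2 * e * a <= 2 * e * 1 by rewrite ler_wpM2l // mulr_ge0.
  by move: h h'; rewrite mulrA -[_ * a]mulrC; lra.
(* Here the signs are opposite, so [|t01 + t12|] is the difference of the lengths. Orderability then
   forces the shorter one to be at most [e], while [eta * a] is at most that length plus [e]. *)
have : eta * a <= 2 * e.
  move: gt; rewrite mulrBr mulrDr; move: u01 u12 u02 b01 b12 b02.
  move: (ler_norm t01) (ler_norm (- t01)) (ler_norm t12) (ler_norm (- t12)).
  move: (ler_norm (t01 + t12)) (ler_norm (- (t01 + t12))); rewrite !normrN.
  by case: (ger0P t01); case: (ger0P t12); case: (ger0P (t01 + t12)); lra.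
move=> h; have h2 : d01 + d12 - d02 <= 2 by lra.
apply: (@le_trans _ _ (2 * (eta * a))); last by lra.
by rewrite ler_pM2r.
Qed.

Lemma near_line_excess (alpha : R) : 0 < alpha <= 1 -> exists2 C : R, 0 < C &
  forall p0 p1 p2 v r,
  v \in layer R (deg G) 1 -> dot v v = 1 -> (forall k, 0 < r k) ->
  near_line v r p0 -> near_line v r p1 -> near_line v r p2 ->
  alpha <= dHS G eta p0 p1 <= 1 -> alpha <= dHS G eta p1 p2 <= 1 ->
  alpha <= dHS G eta p0 p2 <= 1 ->
  dHS G eta p0 p1 <= dHS G eta p0 p2 -> dHS G eta p1 p2 <= dHS G eta p0 p2 ->
  dHS G eta p0 p1 + dHS G eta p1 p2 - dHS G eta p0 p2 <= C * total r.
Proof.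
move=> al; have [C C0 Cd] := near_line_dist al.
have al0 : 0 < alpha by case/andP: al.
have D0 : 0 <= 4 / (eta * alpha) * C.
  by rewrite !mulr_ge0 // invr_ge0 ltW // mulr_gt0.
(* The summand 2 handles [total r > 1], where the excess is at most 2 because all distances are at
   most 1. *)
exists (2 + 4 / (eta * alpha) * C); first by rewrite ltr_pwDl.
move=> p0 p1 p2 v r v1 vv r0 n0 n1 n2 d01 d12 d02 o01 o12.
have S0 : 0 <= total r by apply: sumr_ge0 => k _; rewrite exprn_ge0 // ltW.
have [S1|/ltW S1] := leP (total r) 1; last first.
  case/andP: d01 => _ d01; case/andP: d12 => _ d12; case/andP: d02 => d02 _.
  have : 2 * 1 <= (2 + 4 / (eta * alpha) * C) * total r.
    by apply: ler_pM => //; rewrite lerDl.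
  by lra.
have low p q : `|dot q v - dot p v| <= eta * dHS G eta p q.
  apply: le_trans (dot_le_NHS eta_gt0 _ v1 vv).
  by rewrite dot_cmul // dotNl addrC.
apply: (@le_trans _ _ (4 / (eta * alpha) * (C * total r))); last first.
  by rewrite mulrA ler_wpM2r // lerDr.
have tt : dot p2 v - dot p0 v = (dot p1 v - dot p0 v) + (dot p2 v - dot p1 v) by ring.
have u01 := Cd _ _ _ _ v1 vv r0 S1 n0 n1 d01.
have u12 := Cd _ _ _ _ v1 vv r0 S1 n1 n2 d12.
have u02 := Cd _ _ _ _ v1 vv r0 S1 n0 n2 d02.
have b02 := low p0 p2; rewrite tt in u02 b02.
case/andP: d01 => a01 d01; case/andP: d12 => a12 d12.
exact: (orderable_real al (mulr_ge0 C0 S0) d01 d12 a01 a12 o01 o12 u01 u12 u02).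
Qed.

End NearLine.

(** * Nondegeneracy of the first layer, and the excess bound for a fixed horizontal line *)

Section StratifiedBeta.
Set Implicit Arguments.
Unset Strict Implicit.
Variables (R : realType) (s n : nat) (G : carnotGroup R s n).
Implicit Types (x y z v g : 'rV[R]_n) (k : nat) (L E : set 'rV[R]_n).
Local Notation mul := (cmul G).

(** A zero first layer would make every higher layer zero, as each is spanned by brackets with it;
    layer 0 is zero since degrees start at 1. This contradicts the nonzero top layer. *)
Lemma layer1_neq0 : layer R (deg G) 1 != 0%VS.
Proof.
apply/negP => /eqP V1.
suff V0 d : layer R (deg G) d = 0%VS by case: (@top_layer_neq0 _ _ _ G); exact: V0.
case: d => [|[|d]] //.
  apply/eqP; rewrite -subv0; apply/subvP => x /mem_layerP x0; rewrite memv0.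
  apply/eqP/rowP => m; rewrite x0 ?mxE //.
  by have /andP[] := deg_bounds G m; rewrite lt0n.
rewrite -(bracket_strat G (isT : (1 <= d.+1)%N)) V1 /bracketv.
by rewrite (size0nil (s := vbasis 0)) ?span_nil // size_tuple dimv0.
Qed.

Lemma exists_horizontal : exists2 v, v \in layer R (deg G) 1 & v != 0.
Proof. by exists (vpick (layer R (deg G) 1)); rewrite ?memv_pick // vpick0 layer1_neq0. Qed.

Lemma step_gt0 : (0 < s)%N.
Proof.
have [v _ /rV0Pn[m _]] := exists_horizontal.
by have /andP[] := deg_bounds G m; apply: leq_trans.
Qed.

Variables (eta : R) (eta_gt0 : 0 < eta).
Local Notation NHS := (NHS G eta).
Local Notation dist := (dHS G eta).

Lemma qdHS_cproj k x y :
  qdHS G eta k (cproj G k x) (cproj G k y) = NHS (cproj G k (mul (- x) y)).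
Proof. by rewrite /qdHS /qmul -cprojN cmul_cproj. Qed.

Lemma qdist_set_le k x y L : L y ->
  qdist_set G eta k (cproj G k x) (cproj G k @` L) <= NHS (cproj G k (mul (- x) y)).
Proof.
move=> Ly; rewrite -qdHS_cproj; apply: ge_inf.
  by exists 0 => _ [u _ <-]; exact: NHS_ge0.
by exists (cproj G k y) => //; exists y.
Qed.

Lemma qdist_set_ge0 k x L : 0 <= qdist_set G eta k x L.
Proof.
rewrite /qdist_set; set A := (X in inf X).
(* On the empty set [inf] takes the default value 0. *)
have [->|A0] := eqVneq A set0; first by rewrite inf0.
apply: lb_le_inf; first exact/set0P.
by move=> _ [u _ <-]; exact: NHS_ge0.
Qed.

Lemma qdist_set_lt k x L (a : R) : L !=set0 ->
  qdist_set G eta k (cproj G k x) (cproj G k @` L) < a ->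
  exists2 y, L y & NHS (cproj G k (mul (- x) y)) < a.
Proof.
move=> [y0 Ly0] /inf_lt[].
  by exists (qdHS G eta k (cproj G k x) (cproj G k y0)), (cproj G k y0) => //; exists y0.
by move=> _ [_ [y Ly <-] <-]; rewrite qdHS_cproj; exists y.
Qed.

Definition deviations E x (rho : R) L k : set R :=
  [set (qdist_set G eta k (cproj G k z) (cproj G k @` L) / rho) ^+ (2 * k)
  | z in E `&` dball G eta x rho].

(** Without an upper bound [sup] would be a default value. One point [g] of [L] suffices: relative
    to [x], both [z] and [g] lie in boxes of scale [rho], hence so does [mul (- z) g]. *)
Lemma deviations_ubound E x (rho : R) L k : 0 < rho -> L !=set0 ->
  has_ubound (deviations E x rho L k).
Proof.
move=> r0 [g Lg]; pose M := `|dilation G rho^-1 (mul (- x) g)|.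
have M0 : 0 <= M := normr_ge0 _.
have [K K0 Kb] := cmul_box G (addr_ge0 (ltW eta_gt0) M0).
have [K' K0' Kb'] := NHS_box G eta_gt0 K0.
exists (K' ^+ (2 * k)) => _ [z [_ xz] <-].
have q0 : 0 <= qdist_set G eta k (cproj G k z) (cproj G k @` L) / rho.
  by rewrite divr_ge0 ?qdist_set_ge0 ?ltW.
apply: lerXn2r; rewrite ?nnegrE ?(ltW K0') // ler_pdivrMr //.
apply: le_trans (qdist_set_le k z Lg) _; apply: Kb' => // m.
apply: (@le_trans _ _ `|mul (- z) g 0 m|).
  by rewrite mxE; case: ifP => // _; rewrite normr0.
have -> : mul (- z) g = mul (- (mul (- x) z)) (mul (- x) g).
  by rewrite cmulNN opprK -cmulA cmulKVg.
apply: Kb => // j.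
  rewrite mxE normrN; apply: le_trans (NHS_lt_box eta_gt0 xz j) _.
  by rewrite ler_wpM2r ?exprn_ge0 ?(ltW r0) // lerDl.
apply: (@le_trans _ _ (M * rho ^+ deg G j)); last first.
  by rewrite ler_wpM2r ?exprn_ge0 ?(ltW r0) // lerDr ltW.
have := coord_le_norm (dilation G rho^-1 (mul (- x) g)) j.
rewrite mxE normrM exprVn normfV (ger0_norm (exprn_ge0 _ (ltW r0))).
by rewrite mulrC ler_pdivrMr ?exprn_gt0.
Qed.

Definition level_dev E x rho L k : R := sup (deviations E x rho L k).

(** The centre [x] lies in [E] and in its own ball, so it contributes an even power to the
    supremum. *)
Lemma level_dev_ge0 E x rho L k : E x -> 0 < rho -> L !=set0 ->
  0 <= level_dev E x rho L k.
Proof.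
move=> Ex r0 L0.
have xx : dist x x < rho.
  rewrite /dHS cmulNg; apply: (@le_lt_trans _ _ (rho / 2)); last by lra.
  by apply: NHS0_le => //; lra.
have /(ub_le_sup (deviations_ubound E x k r0 L0)) : deviations E x rho L k
    ((qdist_set G eta k (cproj G k x) (cproj G k @` L) / rho) ^+ (2 * k)).
  by exists x.
by apply: le_trans; rewrite exprM exprn_ge0 // sqr_ge0.
Qed.

(* The strict inequality on a is there because the distance to L need not be
   attained. *)
Lemma level_dev_lt E x rho L k z (a : R) : (0 < k)%N -> E z -> dist x z < rho ->
  0 < rho -> L !=set0 -> level_dev E x rho L k < a ->
  exists2 y, L y & NHS (cproj G k (mul (- z) y)) < rho * a `^ (2 * k)%:R^-1.
Proof.
move=> k0 Ez xz r0 L0 da.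
apply: qdist_set_lt => //; rewrite mulrC -ltr_pdivrMr //.
set q := _ / rho; have q0 : 0 <= q by rewrite divr_ge0 ?qdist_set_ge0 ?ltW.
have qa : q ^+ (2 * k) < a.
  apply: le_lt_trans da; apply: (ub_le_sup (deviations_ubound E x k r0 L0)).
  by exists z.
have k2 : 0 < (2 * k)%:R :> R by rewrite ltr0n muln_gt0.
have <- : (q ^+ (2 * k)) `^ (2 * k)%:R^-1 = q.
  by rewrite -powR_mulrn // -powRrM mulfV ?gt_eqF // powRr1.
apply: gt0_ltr_powR; rewrite ?invr_gt0 // nnegrE ?exprn_ge0 //.
by apply: le_trans (ltW qa); rewrite exprn_ge0.
Qed.

(** The constant is uniform in [L], which allows the infimum over lines to be taken afterwards. *)
Lemma line_excess (alpha : R) : 0 < alpha <= 1 -> exists2 C : R, 0 < C &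
  forall E x p0 p1 p2 (l : R) L, 0 < l -> horizontal_line G L -> E x ->
  (forall p, p \in [:: p0; p1; p2] -> E p /\ dist x p < 2 * l) ->
  alpha * l <= dist p0 p1 <= l -> alpha * l <= dist p1 p2 <= l ->
  alpha * l <= dist p0 p2 <= l ->
  dist p0 p1 <= dist p0 p2 -> dist p1 p2 <= dist p0 p2 ->
  dist p0 p1 + dist p1 p2 - dist p0 p2 <=
    C * (\sum_(1 <= k < s.+1) level_dev E x (2 * l) L k) * l.
Proof.
move=> al; have [C C0 CE] := near_line_excess G eta_gt0 al.
(* The balls have radius [2 * l], so after rescaling by [l] the distances carry a factor 2, which
   becomes [4 ^+ k <= 4 ^+ s] in the power [2 * k]. *)
exists (C * 4 ^+ s); first by rewrite mulr_gt0 ?exprn_gt0.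
move=> E x p0 p1 p2 l L l0 [g [v' [v'1 v'0 LE]]] Ex pE d01 d12 d02 o01 o12.
have L0 : L !=set0 by rewrite LE; exists (mul g (0 *: v')), 0.
have l20 : 0 < 2 * l by lra.
have vv'0 : 0 < dot v' v'.
  have /rV0Pn[m vm] := v'0; rewrite /dot (bigD1 m) //= ltr_pwDl //.
    by rewrite -expr2 exprn_even_gt0.
  by apply: sumr_ge0 => i _; rewrite -expr2 sqr_ge0.
pose c := Num.sqrt (dot v' v'); have c0 : 0 < c by rewrite sqrtr_gt0.
pose v := c^-1 *: v'; have v1 : v \in layer R (deg G) 1 by exact: memvZ.
have dotC y z : dot y z = dot z y by apply: eq_bigr => i _; rewrite mulrC.
have vv : dot v v = 1.
  rewrite dotZl dotC dotZl -[dot v' v'](sqr_sqrtr (ltW vv'0)) -/c.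
  by field; rewrite gt_eqF.
(* Moves [L] to a line through the identity and the scale [l] to 1. *)
pose P p := dilation G l^-1 (mul (- g) p).
have PP p q : dist (P p) (P q) = dist p q / l.
  rewrite /dHS /P -dilationN cmul_dilation NHS_dilation ?invr_gt0 // mulrC.
  by rewrite cmulNN opprK -cmulA cmulKVg.
set B := level_dev E x (2 * l) L.
have B0 k : 0 <= B k by exact: level_dev_ge0.
have scaled p q : alpha * l <= dist p q <= l -> alpha <= dist (P p) (P q) <= 1.
  by rewrite PP ler_pdivlMr // ler_pdivrMr // mul1r.
rewrite -ler_pdivrMr //.
have -> : (dist p0 p1 + dist p1 p2 - dist p0 p2) / l =
    dist (P p0) (P p1) + dist (P p1) (P p2) - dist (P p0) (P p2).
  by rewrite !PP -mulrDl -mulrBl.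
apply/ler_addgt0Pr => e e0.
(* A slack making the inequality of [level_dev_lt] strict; the [s] copies of it, multiplied by
   [C * 4 ^+ s], add up to [e]. *)
pose eps := e / (C * 4 ^+ s * s%:R).
have s0 : 0 < s%:R :> R by rewrite ltr0n step_gt0.
have eps0 : 0 < eps by rewrite divr_gt0 // !mulr_gt0 ?exprn_gt0.
pose r k := 2 * (B k + eps) `^ (2 * k)%:R^-1.
have r0 k : 0 < r k by rewrite mulr_gt0 // powR_gt0 // ltr_wpDl.
have near p : p \in [:: p0; p1; p2] -> near_line G eta v r (P p).
  move=> /pE[Ep xp] k /andP[k1 ks].
  have [|y] := @level_dev_lt E x (2 * l) L k p (B k + eps) k1 Ep xp l20 L0.
    by rewrite ltrDl.
  (* Since [v' = c *: v], the point of [L] with parameter [t] is sent by [P] to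
     [(t * c / l) *: v]. *)
  rewrite LE => -[t _ <-] py; exists (t * c / l).
  rewrite -(ltr_pM2l l0) -NHS_dilation // -cproj_dilation -cmul_dilation /r.
  rewrite dilationN dilationM mulfV ?gt_eqF // dilation1 dilation_layer1 ?memvZ //.
  rewrite /v !scalerA cmulNN opprK -cmulA.
  have -> : l * (t * c / l) * c^-1 = t by field; rewrite !gt_eqF.
  by rewrite mulrA [l * 2]mulrC.
have n0 := near p0 (mem_head _ _).
have n1 : near_line G eta v r (P p1) by apply: near; rewrite !inE eqxx orbT.
have n2 : near_line G eta v r (P p2) by apply: near; rewrite !inE eqxx !orbT.
have o01' : dist (P p0) (P p1) <= dist (P p0) (P p2) by rewrite !PP ler_pM2r ?invr_gt0.
have o12' : dist (P p1) (P p2) <= dist (P p0) (P p2) by rewrite !PP ler_pM2r ?invr_gt0.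
have := CE _ _ _ v r v1 vv r0 n0 n1 n2 (scaled _ _ d01) (scaled _ _ d12)
  (scaled _ _ d02) o01' o12'.
move=> /le_trans; apply.
apply: (@le_trans _ _ (C * (4 ^+ s * \sum_(1 <= k < s.+1) (B k + eps)))).
  rewrite ler_pM2l // mulr_sumr big_nat_cond [leRHS]big_nat_cond.
  apply: ler_sum => k /andP[/andP[k1 ks] _].
  have Be : 0 < B k + eps by rewrite ltr_wpDl.
  have k2 : (2 * k)%:R != 0 :> R by rewrite pnatr_eq0 muln_eq0 /= -lt0n.
  rewrite /r exprMn -[X in _ * X]powR_mulrn ?powR_ge0 // -powRrM mulVf //.
  rewrite powRr1 ?(ltW Be) // ler_wpM2r ?(ltW Be) // exprM.
  have -> : 2 ^+ 2 = 4 :> R by ring.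
  by apply: ler_weXn2l; rewrite ?ler1n.
rewrite big_split /= sumr_const_nat subn1 /= mulrA mulrDr lerD2l -[_ *+ s]mulr_natr /eps.
rewrite le_eqVlt; apply/orP; left; apply/eqP.
by field; rewrite !gt_eqF ?exprn_gt0.
Qed.

End StratifiedBeta.

(** * Passage to the infimum over horizontal lines *)

Theorem corollary6p8 (R : realType) (s n : nat) (G : carnotGroup R s n) :
  exists2 eta0 : R, 0 < eta0 &
  forall eta : R, 0 < eta <= eta0 ->
  forall alpha : R, 0 < alpha < 1 ->
  exists2 C : R, 0 < C &
  forall (E : set 'rV[R]_n) (p : 'I_3 -> 'rV[R]_n) (l : R),
    (forall i, E (p i)) ->
    orderable (dHS G eta) (p 0) (p 1) (p 2) ->
    0 < l ->
    (forall i j, i != j -> alpha * l <= dHS G eta (p i) (p j) <= l) ->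
    forall i : 'I_3,
      dHS G eta (p 0) (p 1) + dHS G eta (p 1) (p 2) - dHS G eta (p 0) (p 2)
        <= C * strat_beta G eta E (p i) (2 * l) ^+ (2 * s) * l.
Proof.
(* The witness is arbitrary: the estimates above are proved for every positive [eta]. *)
exists 1 => // eta /andP[eta0 _] alpha /andP[al0 /ltW al1].
have al : 0 < alpha <= 1 by rewrite al0.
have [C C0 Cexc] := line_excess G eta0 al.
exists C => // E p l Ep op l0 dp i.
have o01 : dHS G eta (p 0) (p 1) <= dHS G eta (p 0) (p 2).
  by apply: le_trans op; rewrite le_max lexx.
have o12 : dHS G eta (p 1) (p 2) <= dHS G eta (p 0) (p 2).
  by apply: le_trans op; rewrite le_max lexx orbT.
have near j : E (p j) /\ dHS G eta (p i) (p j) < 2 * l.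
  split=> //; have [->|ij] := eqVneq i j.
    rewrite /dHS cmulNg.
    by apply: le_lt_trans (NHS0_le G eta0 l0) _; lra.
  by have /andP[_ /le_lt_trans] := dp _ _ ij; apply; lra.
have near3 q : q \in [:: p 0; p 1; p 2] -> E q /\ dHS G eta (p i) q < 2 * l.
  by rewrite !inE => /or3P[] /eqP->.
have l20 : 0 < 2 * l by lra.
rewrite /strat_beta; set A := (X in inf X).
(* Horizontal lines exist because the first layer is nonzero, so [inf A] is a genuine infimum. *)
have A0 : A !=set0.
  have [v v1 v0] := exists_horizontal G.
  pose L := [set cmul G 0 (t *: v) | t in [set: R]].
  by eexists; exists L; [exists 0, v | reflexivity].
have lbA : lbound A ((dHS G eta (p 0) (p 1) + dHS G eta (p 1) (p 2)
    - dHS G eta (p 0) (p 2)) / (C * l)).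
  move=> _ [L hL <-]; rewrite ler_pdivrMr ?mulr_gt0 // mulrCA mulrA.
  by apply: Cexc => //; apply: dp.
(* Nonnegativity is what lets the power [2 * s] cancel the root in [strat_beta]. *)
have infA0 : 0 <= inf A.
  apply: lb_le_inf => // _ [L hL <-]; apply: sumr_ge0 => k _.
  apply: level_dev_ge0 => //.
  by case: hL => g [v [_ _ ->]]; exists (cmul G g (0 *: v)), 0.
have s2 : (2 * s)%:R != 0 :> R by rewrite pnatr_eq0 muln_eq0 /= -lt0n (step_gt0 G).
rewrite -[X in C * X]powR_mulrn ?powR_ge0 // -powRrM mulVf // powRr1 //.
rewrite mulrAC [leRHS]mulrC -ler_pdivrMr ?mulr_gt0 //.
exact: lb_le_inf.
Qed.
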